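(* Let $q$ be a fixed prime power and $k\ge 2$ a fixed integer. Let $\mathfrak m=(m_1,\dots,m_k)$ and $\mathfrak n=(n_1,\dots,n_k)$ be $k$-tuples of nonnegative integers such that $m_k>0$, $n_k>0$ and $\max\{m_i,n_i\}>1$ for all $1\le i\le k-1$. Then $$P_k(\mathfrak m;\mathfrak n)=N_k(\mathfrak m)N_k(\mathfrak n)-q\,N_k(m_1,\dots,m_{k-1},m_k-1)\,N_k(n_1,\dots,n_{k-1},n_k-1)+O\Bigl(q^{\max_{1\le j\le k-1}\bigl(\frac{m_j}{m_j+1}\prod_{i=1}^k(m_i+1)+\frac{n_j}{n_j+1}\prod_{i=1}^k(n_i+1)\bigr)}\Bigr),$$ where the constant in the $O$-term is independent of $\mathfrak m$ and $\mathfrak n$ (it may depend on $q,k$).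
   Context: $\mathbb F_q$ is the finite field with $q$ elements. Two polynomials in $\mathbb F_q[x_1,\dots,x_k]$ are identified if they differ by a factor in $\mathbb F_q^\times$; the classes are called normalized polynomials. The vector degree of a nonzero $f$ is $\operatorname{Deg} f=(\deg_{x_1}f,\dots,\deg_{x_k}f)$. For a $k$-tuple $\mathfrak m$ of nonnegative integers, $\mathcal N_k(\mathfrak m)$ is the set of normalized polynomials $f\in\mathbb F_q[x_1,\dots,x_k]$ with $\operatorname{Deg} f=\mathfrak m$, and $N_k(\mathfrak m)=|\mathcal N_k(\mathfrak m)|$. $P_k(\mathfrak m;\mathfrak n)=|\{(f,g)\in\mathcal N_k(\mathfrak m)\times\mathcal N_k(\mathfrak n):\gcd(f,g)=1\}|$. *)

(* Defs.v *)
From HB Require Import structures.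
From mathcomp Require Import all_boot all_order all_algebra.
From mathcomp Require Import generic_quotient finmap mpoly.
From mathcomp Require Import boolp classical_sets functions cardinality.

Set Implicit Arguments.
Unset Strict Implicit.
Unset Printing Implicit Defensive.
Import Order.TTheory GRing.Theory Num.Theory.

Local Open Scope classical_set_scope.
Local Open Scope ring_scope.
Local Open Scope quotient_scope.

Section NormalizedPolynomials.
Variables (F : finFieldType) (k : nat).
Implicit Types (f g : {mpoly F[k]}) (m n : {ffun 'I_k -> nat}).

Definition proportional f g : bool := [exists c : F, (c != 0) && (f == c *: g)].

Lemma proportionalP f g :
  reflect (exists2 c : F, c != 0 & f = c *: g) (proportional f g).
Proof.
apply: (iffP existsP) => [[c /andP[c0 /eqP e]]|[c c0 e]]; exists c => //.
by rewrite c0 e /=.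
Qed.

Lemma proportional_refl : reflexive proportional.
Proof. by move=> f; apply/proportionalP; exists 1; rewrite ?oner_eq0 ?scale1r. Qed.

Lemma proportional_sym : ssrbool.symmetric proportional.
Proof.
have imp f g : proportional f g -> proportional g f.
  case/proportionalP=> c c0 ->; apply/proportionalP; exists c^-1.
    by rewrite invr_eq0.
  by rewrite scalerA mulVf ?scale1r.
by move=> f g; apply/idP/idP; apply: imp.
Qed.

Lemma proportional_trans : transitive proportional.
Proof.
move=> g f h /proportionalP[c c0 ->] /proportionalP[d d0 ->].
by apply/proportionalP; exists (c * d); rewrite ?mulf_neq0 // scalerA.
Qed.

Canonical proportional_equiv :=
  EquivRel proportional proportional_refl proportional_sym proportional_trans.

(* Besides the normalized polynomials this also contains the class of 0, which
   npolys below leaves out. *)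
Definition polyclass := {eq_quot proportional_equiv}.

(* Only meaningful for f != 0; vdeg 0 is the zero vector. *)
Definition vdeg f : {ffun 'I_k -> nat} :=
  [ffun i : 'I_k => (\max_(u <- msupp f) (u : 'X_{1..k}) i)%N].

Definition npolys m : set polyclass :=
  [set C | exists f, [/\ f != 0, vdeg f = m & C = \pi_polyclass f]].

Definition mdivides f g : Prop := exists h, g = h * f.

Definition is_gcd d f g : Prop :=
  [/\ mdivides d f, mdivides d g &
      forall e, mdivides e f -> mdivides e g -> mdivides e d].

Definition coprime_pairs m n : set (polyclass * polyclass) :=
  [set p | [/\ npolys m p.1, npolys n p.2 & is_gcd 1 (repr p.1) (repr p.2)]].

(* fset_set A is the empty fset when A is infinite; see finite_npolys and
   finite_coprime_pairs. *)
Definition Ncount m : nat := #|` fset_set (npolys m)|.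
Definition Pcount m n : nat := #|` fset_set (coprime_pairs m n)|.

Lemma finite_npolys m : finite_set (npolys m).
Proof.
pose b := (\sum_i m i)%N.+1.
pose h (c : {ffun 'X_{1..k < b} -> F}) : polyclass :=
  \pi_polyclass (\sum_(u : 'X_{1..k < b}) c u *: 'X_[u]).
apply: (@sub_finite_set _ _ (range h)); last exact/finite_image/finite_finset.
move=> C [f [_ degf ->]]; exists [ffun u : 'X_{1..k < b} => f@_u] => //.
rewrite /h; congr (\pi_polyclass _).
have szf : (msize f <= b)%N.
  rewrite msizeE; apply/bigmax_leqP_seq => u uf _.
  rewrite ltnS mdegE leq_sum // => i _.
  by rewrite -degf ffunE; exact: (bigop.leq_bigmax_seq (F := fun u : 'X_{1..k} => u i) u).
by rewrite [RHS](mpolywE szf); apply: eq_bigr => u _; rewrite ffunE.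
Qed.

Lemma finite_coprime_pairs m n : finite_set (coprime_pairs m n).
Proof.
apply: (@sub_finite_set _ _ (npolys m `*` npolys n)); first by move=> p [].
exact: finite_setX (finite_npolys m) (finite_npolys n).
Qed.

Lemma coprime_pairs_pi m n f g :
  coprime_pairs m n (\pi_polyclass f, \pi_polyclass g) <->
  [/\ npolys m (\pi_polyclass f), npolys n (\pi_polyclass g) & is_gcd 1 f g].
Proof.
have divC e f1 f2 : proportional f1 f2 -> mdivides e f1 <-> mdivides e f2.
  have imp f3 f4 : proportional f3 f4 -> mdivides e f4 -> mdivides e f3.
    by case/proportionalP=> c _ -> [h ->]; exists (c *: h); rewrite scalerAl.
  by move=> f12; split; apply: imp; rewrite // proportional_sym.
have prop_repr f1 : proportional (repr (\pi_polyclass f1)) f1.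
  by apply/eqquotP; rewrite -[LHS]/(\pi_polyclass _) reprK.
have df e := divC e _ _ (prop_repr f); have dg e := divC e _ _ (prop_repr g).
split=> [] [Nf Ng [d1 d2 d3]]; split=> //; split.
- exact/df.
- exact/dg.
- by move=> e /df ef /dg eg; apply: d3.
- exact/df.
- exact/dg.
- by move=> e /df ef /dg eg; apply: d3.
Qed.

(* The coordinate of index i with i.+1 = k is the last one. *)
Definition pred_last m : {ffun 'I_k -> nat} :=
  [ffun i : 'I_k => if i.+1 == k then (m i).-1 else m i].

End NormalizedPolynomials.

(* Main.v *)
(* The vector degree is additive, so everything reduces to counting pairs
   according to the vector degree of a common divisor; unique factorization in
   several variables is not needed.

   Let x be the last variable.  By Bezout in F[x], every pair (f, g) of nonzero
   polynomials is uniquely d * (a, b) with d in F[x] monic and a, b without common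
   factor in F[x] - F.  Writing a nonconstant d as d' * x + c and sending (f, g)
   to (c, d' * (a, b)) identifies the pairs of degrees (m, n) having a nonconstant
   common factor in F[x] with F times all the pairs of degrees (m - e_k, n - e_k).
   This gives the main terms exactly.

   The remaining non-coprime pairs have a common divisor of some vector degree l
   with l_j > 0 for some j < k.  There are at most q^phi(l) of them for each l, where
   phi(l) = prod (l_i + 1) + prod (m_i - l_i + 1) + prod (n_i - l_i + 1),
   and phi(l) + sum l_i exceeds the exponent of the error term by at most 3, so
   that the sum over l is dominated by a product of k geometric series. *)
From HB Require Import structures.
Require Import Defs.
From mathcomp Require Import all_boot all_order all_algebra.
From mathcomp Require Import generic_quotient finmap mpoly.
From mathcomp Require Import boolp classical_sets functions cardinality.
From mathcomp Require Import zify.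

Import Order.TTheory GRing.Theory Num.Theory.
Local Open Scope ring_scope.

Set Implicit Arguments.
Unset Strict Implicit.
Unset Printing Implicit Defensive.

(** * Vector degrees and the subring F[x] *)

Section VectorDegree.
Variables (F : finFieldType) (k : nat).
Implicit Types (f g : {mpoly F[k]}) (d : {poly F}) (u : 'X_{1..k}).

Lemma leq_vdeg f u i : u \in msupp f -> (u i <= vdeg f i)%N.
Proof.
move=> uf; rewrite ffunE.
exact: (bigop.leq_bigmax_seq (F := fun u : 'X_{1..k} => u i) u).
Qed.

Lemma vdeg_leqP f i b :
  reflect (forall u, u \in msupp f -> (u i <= b)%N) (vdeg f i <= b)%N.
Proof.
apply: (iffP idP) => [le_b u uf|H].
  exact: leq_trans (leq_vdeg i uf) le_b.
by rewrite ffunE; apply/bigmax_leqP_seq => u uf _; apply: H.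
Qed.

Lemma vdeg_attained f i : f != 0 ->
  exists2 u, u \in msupp f & u i = vdeg f i.
Proof.
move=> f0; have /hasP[u uf /eqP e] :
    has (fun u : 'X_{1..k} => u i == vdeg f i) (msupp f).
  apply/contraT => /hasPn H.
  have lt u : u \in msupp f -> (u i < vdeg f i)%N.
    by move=> uf; rewrite ltn_neqAle H // leq_vdeg.
  have v0 : (0 < vdeg f i)%N by apply: leq_trans (lt _ (mlead_supp f0)).
  suff : (vdeg f i <= (vdeg f i).-1)%N by rewrite leqNgt prednK // leqnn.
  by apply/vdeg_leqP => u /lt; rewrite -{1}(prednK v0).
by exists u.
Qed.

(* The substitution x_i |-> x_i T turns the degree in x_i into the degree in T,
   which is additive since the coefficients of T form an integral domain. *)
Definition split_var (i : 'I_k) : {mpoly F[k]} -> {poly {mpoly F[k]}} :=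
  mmap (polyC \o @mpolyC k F)
       (fun r => if r == i then 'X_r *: 'X else ('X_r)%:P).

(** The substitution sends the monomial with exponents [u] to itself times T^(u i), so the
    coefficient of T^j collects the monomials with exponent [j] in x_i. *)
Lemma mcoeff_split_var i f j u :
  ((split_var i f)`_j)@_u = f@_u * (u i == j)%:R.
Proof.
have mon v : mmap1 (fun r : 'I_k => if r == i then 'X_r *: 'X else ('X_r)%:P) v
             = ('X_[F, v])%:P * 'X^(v i).
  rewrite /mmap1 mpolyXE_id rmorph_prod /= (bigD1 i) //= eqxx.
  rewrite [in RHS](bigD1 i) //= exprZn -mul_polyC -!mulrA; congr (_ * _).
  rewrite [LHS]mulrC; congr (_ * _); apply: eq_bigr => r /negbTE ->.
  by rewrite rmorphXn.
rewrite /split_var /mmap coef_sum raddf_sum /=.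
rewrite [in RHS](mpolyE f) raddf_sum big_distrl /=.
apply: eq_bigr => v _; rewrite mon mulrA -polyCM coefCM coefXn.
rewrite mcoeffZ mcoeffX mul_mpolyC -scalerAl mcoeffZ -mulrA; congr (_ * _).
rewrite -[X in _ * X]mpolyC_nat mulrC mcoeffCM mcoeffX mulrC.
have [->|_] := eqVneq v u; first by rewrite eq_sym mulrC.
by rewrite !mul0r.
Qed.

Lemma size_split_var i f : f != 0 -> size (split_var i f) = (vdeg f i).+1.
Proof.
move=> f0; apply/eqP; rewrite eqn_leq; apply/andP; split.
  apply/leq_sizeP => j lt_j; apply/mpolyP => u.
  rewrite mcoeff_split_var mcoeff0; have [uf|/memN_msupp_eq0 ->] := boolP (u \in msupp f).
    have := leq_ltn_trans (leq_vdeg i uf) lt_j.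
    by rewrite ltn_neqAle => /andP[/negbTE -> _]; rewrite mulr0.
  by rewrite mul0r.
have [u uf e] := vdeg_attained i f0.
rewrite ltnNge; apply/negP => /leq_sizeP/(_ _ (leqnn _))/(congr1 (mcoeff u)).
rewrite mcoeff_split_var e eqxx mulr1 mcoeff0 => /eqP.
by rewrite mcoeff_eq0 uf.
Qed.

Lemma vdegM f g i : f != 0 -> g != 0 -> vdeg (f * g) i = (vdeg f i + vdeg g i)%N.
Proof.
move=> f0 g0; apply: succn_inj; rewrite -size_split_var ?mulf_neq0 //.
rewrite [split_var i (f * g)]rmorphM /= size_mul -?size_poly_eq0 ?size_split_var //.
by rewrite addSn addnS.
Qed.

Lemma vdegZ (c : F) f : c != 0 -> vdeg (c *: f) = vdeg f.
Proof.
move=> c0; apply/ffunP => i; rewrite !ffunE.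
by apply: perm_big; apply: msuppZ.
Qed.

Section Univariate.
Variable x : 'I_k.

(** The inclusion of F[x] into the full polynomial ring; it makes gcds and Bezout relations of
    [{poly F}] usable there. *)
Definition ev : {poly F} -> {mpoly F[k]} := horner_alg ('X_x : {mpoly F[k]}).
HB.instance Definition _ := GRing.LRMorphism.on ev.

Lemma evX : ev 'X = 'X_x.
Proof. exact: horner_algX. Qed.

Lemma evZ (c : F) d : ev (c *: d) = c *: ev d.
Proof. by rewrite linearZ /= mulr_algl. Qed.

Lemma evE d : ev d = \sum_(j < size d) d`_j *: 'X_[U_(x) *+ j].
Proof.
rewrite -{1}[d]coefK poly_def raddf_sum /=. apply: eq_bigr => j _.
by rewrite evZ rmorphXn /= -mpolyXn -evX.
Qed.

Lemma mcoeff_ev d j : (ev d)@_(U_(x) *+ j) = d`_j.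
Proof.
have inj a b : ((U_(x) *+ a)%MM == (U_(x) *+ b)%MM :> 'X_{1..k}) = (a == b).
  apply/eqP/eqP => [/mnmP/(_ x)|-> //].
  by rewrite !mulmnE mnm1E eqxx !mul1n.
rewrite evE raddf_sum /=; under eq_bigr do rewrite mcoeffZ mcoeffX inj.
have [lt_j|ge_j] := ltnP j (size d); last first.
  rewrite nth_default // big1 // => i _; case: eqVneq => [e|_]; last by rewrite mulr0.
  by move: ge_j; rewrite -e leqNgt ltn_ord.
rewrite (bigD1 (Ordinal lt_j)) //= eqxx mulr1 big1 ?addr0 // => i.
by rewrite -val_eqE /= => /negbTE ->; rewrite mulr0.
Qed.

Lemma msupp_ev d u : u \in msupp (ev d) ->
  exists2 j, u = (U_(x) *+ j)%MM & (j < size d)%N.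
Proof.
rewrite mcoeff_msupp evE raddf_sum /= => nz.
have [/existsP[j /eqP <-]|/existsPn H] :=
    boolP [exists j : 'I_(size d), (U_(x) *+ j)%MM == u]; first by exists j.
case/negP: nz; apply/eqP/big1 => j _.
by rewrite mcoeffZ mcoeffX (negbTE (H j)) mulr0.
Qed.

Lemma ev_inj : injective ev.
Proof. by move=> d d' e; apply/polyP => j; rewrite -!mcoeff_ev e. Qed.

Lemma ev_eq0 d : (ev d == 0) = (d == 0).
Proof. by rewrite -(inj_eq ev_inj) rmorph0. Qed.

Lemma vdeg_ev d i : vdeg (ev d) i = ((i == x) * (size d).-1)%N.
Proof.
have [->|d0] := eqVneq d 0.
  by rewrite rmorph0 size_poly0 muln0 ffunE msupp0 big_nil.
apply/eqP; rewrite eqn_leq; apply/andP; split.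
  apply/vdeg_leqP => u /msupp_ev[j -> lt_j].
  rewrite mulmnE mnm1E eq_sym leq_mul2l -ltnS prednK ?lt_j ?orbT //.
  by case: (size d) lt_j.
have [->|] := eqVneq i x; last by rewrite mul0n.
have : (U_(x) *+ (size d).-1)%MM \in msupp (ev d).
  by rewrite mcoeff_msupp mcoeff_ev -lead_coefE lead_coef_eq0.
by move=> /(leq_vdeg x); rewrite mulmnE mnm1E eqxx.
Qed.

Lemma mlead_ev d : d != 0 -> mlead (ev d) = (U_(x) *+ (size d).-1)%MM.
Proof.
move=> d0; have top : (U_(x) *+ (size d).-1)%MM \in msupp (ev d).
  by rewrite mcoeff_msupp mcoeff_ev -lead_coefE lead_coef_eq0.
have /mlead_supp/msupp_ev[j e lt_j] : ev d != 0 by rewrite ev_eq0.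
have /lemc_mdeg := msupp_le_mlead top.
rewrite e !mdegMn mdeg1 !mul1n => ge_j; congr (_ *+ _)%MM.
by apply/eqP; rewrite eqn_leq ge_j -ltnS prednK ?lt_j // lt0n size_poly_eq0.
Qed.

Lemma mleadc_ev d : mleadc (ev d) = lead_coef d.
Proof.
have [->|d0] := eqVneq d 0; first by rewrite rmorph0 mleadc0 lead_coef0.
by rewrite mlead_ev // mcoeff_ev.
Qed.

(** All monomials of such an [f] are powers of x, so its coefficients can be read off as those of a
    univariate polynomial. *)
Lemma ev_of_vdeg f : (forall i, i != x -> vdeg f i = 0%N) ->
  exists d, f = ev d.
Proof.
move=> H; exists (\poly_(j < (vdeg f x).+1) f@_(U_(x) *+ j)).
have shape u : u \in msupp f -> u = (U_(x) *+ u x)%MM.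
  move=> uf; apply/mnmP => i; rewrite mulmnE mnm1E.
  have [<-|nix] := eqVneq x i; first by rewrite mul1n.
  by apply/eqP; rewrite -leqn0 -(H i) 1?eq_sym // leq_vdeg.
apply/mpolyP => u; have [e|ne] := eqVneq u (U_(x) *+ u x)%MM.
  rewrite e mcoeff_ev coef_poly -e ltnS; case: leqP => // lt.
  by apply: memN_msupp_eq0; apply/negP => /(leq_vdeg x); rewrite leqNgt lt.
rewrite !memN_msupp_eq0 //; apply/negP; last by move/shape/eqP; apply/negP.
case/msupp_ev => j e _; case/eqP: ne.
by rewrite {2}e mulmnE mnm1E eqxx mul1n.
Qed.

End Univariate.
End VectorDegree.

(** * Counting finite sets *)

Definition ncard (T : choiceType) (A : set T) : nat := #|` fset_set A|.

Lemma ncard_setT (T : finType) : ncard [set: T]%classic = #|T|.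
Proof.
rewrite /ncard cardE; apply/perm_size/uniq_perm => [||t].
- exact: fset_uniq.
- exact: enum_uniq.
rewrite in_fset_set ?mem_enum; last exact: finite_finset.
by apply/idP/idP; rewrite !inE.
Qed.

Section FiniteCounting.
Local Open Scope classical_set_scope.
Variables T U : choiceType.

(** Read backwards, [R] is a partial function from [B] onto [A]. Working with relations allows
    correspondences described by existential data. An infinite [A] is harmless, its [ncard] being
    0. *)
Lemma leq_ncard_rel (A : set T) (B : set U) (R : T -> U -> Prop) :
  finite_set B ->
  (forall a, A a -> exists2 b, B b & R a b) ->
  (forall a a' b, A a -> A a' -> R a b -> R a' b -> a = a') ->
  (ncard A <= ncard B)%N.
Proof.
move=> finB tot inj; have [finA|infA] := pselect (finite_set A); last first.
  by rewrite /ncard /fset_set; case: pselect.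
pose g b : option T :=
  if pselect (exists2 a, A a & R a b) is left e then Some (s2val (cid2 e)) else None.
have gP a b : A a -> R a b -> g b = Some a.
  move=> Aa Rab; rewrite /g; case: pselect => [e|[]]; last by exists a.
  by case: cid2 => a' Aa' Ra'b /=; rewrite (inj a' a b).
have Some_inj' : injective (@Some T) by move=> ? ? [].
rewrite /ncard; have -> : #|` fset_set A| = #|` [fset Some a | a in fset_set A]%fset|.
  by rewrite card_imfset.
have : (#|` [fset g b | b in fset_set B]%fset| <= #|` fset_set B|)%N.
  exact: leq_imfset_card.
apply: leq_trans.
apply/fsubset_leq_card/fsubsetP => _ /imfsetP[a /= + ->].
rewrite in_fset_set // inE => Aa; have [b Bb Rab] := tot a Aa.
by apply/imfsetP; exists b; rewrite /= ?in_fset_set ?inE // (gP a).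
Qed.

Lemma ncardX (A : set T) (B : set U) : finite_set A -> finite_set B ->
  ncard (A `*` B) = (ncard A * ncard B)%N.
Proof.
move=> fA fB; rewrite /ncard fset_setX // -(size_allpairs (fun x y => (x, y))).
apply/perm_size/uniq_perm => [||p]; first exact: fset_uniq.
  by apply: allpairs_uniq => // -[? ?] [? ?] _ _ /= [-> ->].
rewrite in_fsetM; apply/andP/allpairsP => [[p1 p2]|[[x y] [xA yB ->]]]; last by [].
by exists p; split=> //; case: p {p1 p2}.
Qed.

Lemma ncard_sub (A B : set T) : finite_set B -> A `<=` B ->
  (ncard A <= ncard B)%N.
Proof.
move=> fB AB; apply: fsubset_leq_card; rewrite -fset_set_sub //.
exact: sub_finite_set fB.
Qed.

Lemma ncardD (A B : set T) : finite_set A -> B `<=` A ->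
  (ncard (A `\` B) + ncard B)%N = ncard A.
Proof.
move=> fA BA; have fB := sub_finite_set BA fA.
rewrite /ncard fset_setD // cardfsDS; last by rewrite -fset_set_sub.
by rewrite subnK // ncard_sub.
Qed.

Lemma ncard_bigcup (I : finType) (P : pred I) (G : I -> set T) (A : set T) :
  (forall i, finite_set (G i)) -> 
  (forall a, A a -> exists2 i, P i & G i a) ->
  (ncard A <= \sum_(i | P i) ncard (G i))%N.
Proof.
move=> finG cov.
suff : finite_set (\big[setU/set0]_(i | P i) G i) /\
    (ncard (\big[setU/set0]_(i | P i) G i) <= \sum_(i | P i) ncard (G i))%N.
  case=> fU; apply: leq_trans; apply: ncard_sub => // a /cov[i Pi Ga].
  by rewrite (bigD1 i) //=; left.
elim/big_ind2: _ => [|S1 n1 S2 n2 [f1 le1] [f2 le2]|i _]; last by split.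
  by split=> //; rewrite /ncard fset_set0 cardfs0.
split; first by rewrite finite_setU.
rewrite /ncard fset_setU // cardfsU; apply: leq_trans (leq_subr _ _) _.
exact: leq_add.
Qed.
End FiniteCounting.

(** * Splitting off the common factor in F[x] *)

Section CoprimeOverOneVariable.
Variables (F : finFieldType) (k : nat) (x : 'I_k).
Implicit Types (f g a b : {mpoly F[k]}) (d : {poly F}).

(** With [f] and [g] viewed as polynomials in the other variables over F[x], their coefficients
    taken together have trivial gcd. *)
Definition coprime_in f g := forall d,
  mdivides (ev x d) f -> mdivides (ev x d) g -> (size d <= 1)%N.

(** Dividing by a nonconstant common factor in F[x] lowers the x-degree of [f], so the process
    ends. *)
Lemma coprime_in_factor f g : f != 0 -> exists d a b,
  [/\ d \is monic, f = ev x d * a, g = ev x d * b & coprime_in a b].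
Proof.
move: {2}(vdeg f x) (leqnn (vdeg f x)) => n; elim: n f g => [|n IH] f g le_n f0.
all: have [co|/existsNP[d /not_implyP[[f' ef] /not_implyP[[g' eg] /negP]]]] :=
  pselect (coprime_in f g).
1,3: by exists 1, f, g; rewrite monic1 rmorph1 !mul1r.
all: rewrite -ltnNge => size_d; have d0 : d != 0 by rewrite -size_poly_gt0 (ltn_trans _ size_d).
all: have f'0 : f' != 0 by apply: contra_neq f0 => e; rewrite ef e mul0r.
all: move: le_n; rewrite ef vdegM ?ev_eq0 // vdeg_ev eqxx mul1n.
  by rewrite leqn0 addn_eq0 -subn1 subn_eq0 leqNgt size_d andbF.
move=> le_n; have [|e [a [b [mone ea eb co]]]] := IH f' g' _ f'0.
  rewrite -ltnS; apply: leq_trans le_n; rewrite -addn1 leq_add2l.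
  by rewrite -subn1 subn_gt0.
have lc0 : lead_coef d != 0 by rewrite lead_coef_eq0.
(* The leading coefficient of [d] moves to the cofactors, which makes the common factor monic. *)
exists ((lead_coef d)^-1 *: d * e), (lead_coef d *: a), (lead_coef d *: b); split.
- by rewrite monicMl // monicE lead_coefZ mulVf.
- by rewrite ea rmorphM /= evZ -!scalerAl -scalerAr scalerA mulVf // scale1r mulrAC (mulrC (ev x e)).
- by rewrite eg eb rmorphM /= evZ -!scalerAl -scalerAr scalerA mulVf // scale1r mulrAC (mulrC (ev x e)).
move=> r; have divZ c u v : c != 0 -> mdivides u (c *: v) -> mdivides u v.
  by move=> c0 [w e']; exists (c^-1 *: w); rewrite -scalerAl -e' scalerA mulVf // scale1r.
by move=> /divZ ra /divZ rb; apply: co; [apply: ra | apply: rb].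
Qed.

(** By symmetry it suffices that [d] divides [d']. After cancelling their gcd, Bezout shows that
    what remains of [d] divides both [a'] and [b'], hence is constant. *)
Lemma coprime_in_factor_uniq d a b d' a' b' :
  d \is monic -> d' \is monic -> coprime_in a b -> coprime_in a' b' ->
  ev x d * a = ev x d' * a' -> ev x d * b = ev x d' * b' ->
  [/\ d = d', a = a' & b = b'].
Proof.
have half d1 a1 b1 d2 a2 b2 : d1 \is monic -> d2 \is monic -> coprime_in a2 b2 ->
    ev x d1 * a1 = ev x d2 * a2 -> ev x d1 * b1 = ev x d2 * b2 -> d1 %| d2.
  move=> mon1 mon2 co ea eb; have [u1 u2] := (monic_neq0 mon1, monic_neq0 mon2).
  have g0 : gcdp d1 d2 != 0 by rewrite gcdp_eq0 negb_and u1.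
  have : (d1 != 0) || (d2 != 0) by rewrite u1.
  move=> /coprimep_div_gcd/Bezout_eq1_coprimepP[[s t] /= st].
  have [e1 e2] := (divpK (dvdp_gcdl d1 d2), divpK (dvdp_gcdr d1 d2)).
  set g := gcdp d1 d2 in g0 st e1 e2.
  set v1 := d1 %/ g in st e1; set v2 := d2 %/ g in st e2.
  have dv c1 c2 : ev x d1 * c1 = ev x d2 * c2 -> mdivides (ev x v1) c2.
    rewrite -e1 -e2 !rmorphM /= -!mulrA ![_ * (ev x g * _)]mulrCA.
    move/mulfI => e; have {}e := e _; move: e; rewrite ev_eq0 => /(_ g0) e.
    (* From s v1 + t v2 = 1 and v1 c1 = v2 c2 follows c2 = s v1 c2 + t v2 c2 = (s c2 + t c1) v1. *)
    exists (ev x s * c2 + ev x t * c1).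
    rewrite mulrDl -!mulrA ![_ * ev x v1]mulrC e.
    rewrite [X in _ = X + _]mulrA [X in _ = _ + X]mulrA -mulrDl -!rmorphM -rmorphD /=.
    by rewrite st rmorph1 mul1r.
  have := co v1 (dv _ _ ea) (dv _ _ eb) => size_v1.
  rewrite -e1 -[X in _ %| X]mul1r -e2 mul1r.
  apply: dvdp_mul => //.
  have v10 : v1 != 0 by apply: contra_neq u1 => e; rewrite -e1 e mul0r.
  have : size v1 == 1%N by rewrite eqn_leq size_v1 size_poly_gt0.
  by rewrite size_poly_eq1 => /eqp_dvdl ->; rewrite dvd1p.
move=> mon mon' co co' ea eb.
have ed : d = d'.
  apply/eqP; rewrite -eqp_monic // /eqp.
  by rewrite (half _ _ _ _ _ _ mon mon' co' ea eb) (half _ _ _ _ _ _ mon' mon co (esym ea) (esym eb)).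
have d0 : ev x d != 0 by rewrite ev_eq0 monic_neq0.
by move: ea eb; rewrite -ed => /(mulfI d0) -> /(mulfI d0) ->.
Qed.
End CoprimeOverOneVariable.

(** * Monic representatives of normalized polynomials *)

Section MonicRepresentatives.
Local Open Scope classical_set_scope.
Local Open Scope quotient_scope.
Variables (F : finFieldType) (k : nat).
Implicit Types (f g : {mpoly F[k]}) (m n : {ffun 'I_k -> nat}).

(** Each class of nonzero polynomials has exactly one member with leading coefficient 1 in the
    monomial order. Counting these members replaces the quotient by a set closed under
    multiplication up to adding degrees. *)
Definition monics m : set {mpoly F[k]} :=
  [set f | mleadc f = 1 /\ vdeg f = m].

Lemma mleadc1_neq0 f : mleadc f = 1 -> f != 0.
Proof. by move=> e; rewrite -mleadc_eq0 e oner_eq0. Qed.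

Lemma mleadc_mul f g : mleadc (f * g) = mleadc f * mleadc g.
Proof.
have [->|f0] := eqVneq f 0; first by rewrite mul0r mleadc0 mul0r.
have [->|g0] := eqVneq g 0; first by rewrite mulr0 mleadc0 mulr0.
by rewrite mleadM // mleadcM.
Qed.

Definition box_poly m (c : {ffun {dffun forall i : 'I_k, 'I_(m i).+1} -> F}) :
    {mpoly F[k]} :=
  \sum_(u : {dffun forall i : 'I_k, 'I_(m i).+1}) c u *: 'X_[[multinom (u i : nat) | i < k]].

Lemma box_poly_vdeg m f : vdeg f = m -> exists c : {ffun _ -> F}, f = @box_poly m c.
Proof.
move=> <-.
exists [ffun u : {dffun forall i : 'I_k, 'I_(vdeg f i).+1} => f@_[multinom (u i : nat) | i < k]].
have inj : injective (fun u : {dffun forall i : 'I_k, 'I_(vdeg f i).+1} =>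
                        [multinom (u i : nat) | i < k]).
  move=> u v /mnmP e; apply/ffunP => i; apply: val_inj.
  by have := e i; rewrite !mnmE.
apply/mpolyP => u; rewrite /box_poly raddf_sum /=.
under eq_bigr do rewrite ffunE mcoeffZ mcoeffX.
have [/existsP[v /eqP <-]|/existsPn H] := boolP [exists v : {dffun forall i : 'I_k, 'I_(vdeg f i).+1},
    [multinom (v i : nat) | i < k] == u].
  rewrite (bigD1 v) //= eqxx mulr1 big1 ?addr0 // => w /negbTE nwv.
  by rewrite (inj_eq inj) nwv mulr0.
rewrite big1 => [|v _]; last by rewrite (negbTE (H v)) mulr0.
apply: memN_msupp_eq0; apply/negP => uf.
have lt i : (u i < (vdeg f i).+1)%N by rewrite ltnS leq_vdeg.
case/negP: (H [ffun i => Ordinal (lt i)]); apply/eqP/mnmP => i.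
by rewrite mnmE (ffunE (fun i : 'I_k => Ordinal (lt i)) i).
Qed.

Lemma finite_monics m : finite_set (monics m).
Proof.
apply: (@sub_finite_set _ _ (range (@box_poly m))); last exact/finite_image/finite_finset.
by move=> f [_ /box_poly_vdeg[c ->]]; exists c.
Qed.

(** A crude count of all coefficient families on the box of exponents, ignoring both the leading
    coefficient and the exact degree. *)
Lemma ncard_monics_leq m : (ncard (monics m) <= #|F| ^ \prod_(i < k) (m i).+1)%N.
Proof.
have -> : (#|F| ^ (\prod_(i < k) (m i).+1))%N =
    #|{ffun {dffun forall i : 'I_k, 'I_(m i).+1} -> F}|.
  by rewrite card_ffun card_dep_ffun foldrE big_map big_enum; congr (_ ^ _)%N;
    apply: eq_bigr => i _; rewrite card_ord.
rewrite -[X in (_ <= X)%N]ncard_setT.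
apply: (leq_ncard_rel (R := fun f c => f = box_poly c)).
- exact: finite_finset.
- by move=> f [_ /box_poly_vdeg[c e]]; exists c.
by move=> f g c _ _ -> ->.
Qed.

Lemma npolys_pi m f : monics m f -> npolys m (\pi_(@polyclass F k) f).
Proof. by case=> /mleadc1_neq0 f0 e; exists f. Qed.

Lemma monics_repr m C : npolys m C -> exists2 f, monics m f & C = \pi_(@polyclass F k) f.
Proof.
case=> f [f0 e ->]; have c0 : mleadc f != 0 by rewrite mleadc_eq0.
exists ((mleadc f)^-1 *: f).
  by split; [rewrite mleadcZE mulVf | rewrite vdegZ ?invr_eq0].
apply/eqquotP; apply/proportionalP; exists (mleadc f) => //.
by rewrite scalerA mulfV // scale1r.
Qed.

Lemma pi_monics_inj m n f g : monics m f -> monics n g ->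
  \pi_(@polyclass F k) f = \pi_(@polyclass F k) g -> f = g.
Proof.
case=> [f1 _] [g1 _] /eqquotP/proportionalP[c c0 e].
by move: f1; rewrite e mleadcZE g1 mulr1 => ->; rewrite scale1r.
Qed.

Lemma ncard_monics m : ncard (monics m) = Ncount F m.
Proof.
apply/eqP; rewrite eqn_leq; apply/andP; split.
  apply: (leq_ncard_rel (R := fun f (C : polyclass F k) => C = \pi f) (finite_npolys F m)).
    by move=> f mf; exists (\pi f) => //; apply: npolys_pi.
  by move=> f g C mf mg -> /(pi_monics_inj mf mg).
apply: (leq_ncard_rel (R := fun (C : polyclass F k) f => C = \pi f) (finite_monics m)).
  by move=> C /monics_repr.
by move=> C C' f _ _ -> ->.
Qed.

Definition monic_pairs m n := monics m `*` monics n.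

Definition coprime_monic_pairs m n : set ({mpoly F[k]} * {mpoly F[k]}) :=
  [set p | monic_pairs m n p /\ is_gcd 1 p.1 p.2].

Lemma finite_monic_pairs m n : finite_set (monic_pairs m n).
Proof. exact: finite_setX (finite_monics m) (finite_monics n). Qed.

Lemma ncard_coprime_monic_pairs m n :
  ncard (coprime_monic_pairs m n) = Pcount F m n.
Proof.
have fin : finite_set (coprime_monic_pairs m n).
  by apply: sub_finite_set (finite_monic_pairs m n) => p [].
pose R (p : {mpoly F[k]} * {mpoly F[k]}) (C : polyclass F k * polyclass F k) :=
  C = (\pi p.1, \pi p.2).
apply/eqP; rewrite eqn_leq; apply/andP; split.
  apply: (leq_ncard_rel (R := R) (finite_coprime_pairs F m n)).
    move=> [f g] [[/= mf mg] co]; exists (\pi f, \pi g) => //.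
    by apply/coprime_pairs_pi; split=> //; apply: npolys_pi.
  move=> [f g] [f' g'] C [[/= mf mg] _] [[/= mf' mg'] _] -> [].
  by move=> /(pi_monics_inj mf mf') -> /(pi_monics_inj mg mg') ->.
apply: (leq_ncard_rel (R := fun C p => R p C) fin).
  move=> [C D] CD; have [/= mC mD _] := CD.
  have [[f mf ef] [g mg eg]] := (monics_repr mC, monics_repr mD).
  exists (f, g); last by rewrite /R /= -ef -eg.
  by split; first (by split); move: CD; rewrite ef eg => /coprime_pairs_pi[].
by move=> C D p _ _ -> ->.
Qed.
End MonicRepresentatives.

(** * Pairs with a common factor in F[x] *)

Section CommonFactors.
Local Open Scope classical_set_scope.
Variables (F : finFieldType) (k : nat) (x : 'I_k).
Implicit Types (f g a b : {mpoly F[k]}) (d : {poly F}) (m n l : {ffun 'I_k -> nat}).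

Definition coprime_in_pairs m n : set ({mpoly F[k]} * {mpoly F[k]}) :=
  [set p | monic_pairs m n p /\ coprime_in x p.1 p.2].

(** Leading coefficients multiply and degrees add, so a monic [d] enters only through its degree and
    can be exchanged for another one. *)
Lemma monics_evM d a m : d \is monic ->
  monics m (ev x d * a) <->
  (mleadc a = 1 /\ forall i, m i = ((i == x) * (size d).-1 + vdeg a i)%N).
Proof.
move=> mon; rewrite /monics /= mleadc_mul mleadc_ev (monicP mon) mul1r.
split=> -[a1 e]; (have a0 := mleadc1_neq0 a1); split=> //.
  by move=> i; rewrite -e vdegM ?ev_eq0 ?monic_neq0 // vdeg_ev.
by apply/ffunP => i; rewrite vdegM ?ev_eq0 ?monic_neq0 // vdeg_ev e.
Qed.

Lemma monic_MXaddC d (c : F) : d \is monic -> d * 'X + c%:P \is monic.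
Proof.
move=> mon; have d0 := monic_neq0 mon; rewrite monicE lead_coefE size_MXaddC.
rewrite (negbTE d0) /= coefD coefMX coefC size_poly_eq0 (negbTE d0) addr0.
by rewrite -lead_coefE (monicP mon).
Qed.

(* Relates d * (a, b), with (a, b) coprime in F[x], to (c, d' * (a, b)) where
   d = d' * x + c. *)
Definition drop_constant (p : {mpoly F[k]} * {mpoly F[k]})
    (cp : F * ({mpoly F[k]} * {mpoly F[k]})) :=
  exists d a b, [/\ d \is monic, coprime_in x a b,
    p = (ev x (d * 'X + cp.1%:P) * a, ev x (d * 'X + cp.1%:P) * b) &
    cp.2 = (ev x d * a, ev x d * b)].

Lemma drop_constant_inj p p' cp : drop_constant p cp -> drop_constant p' cp -> p = p'.
Proof.
case=> d [a [b [mon co -> e]]] [d' [a' [b' [mon' co' -> ]]]].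
rewrite e => /[dup] /(congr1 fst) /= ea /(congr1 snd) /= eb.
by have [-> -> ->] := coprime_in_factor_uniq mon mon' co co' ea eb.
Qed.

Lemma drop_constant_fun p cp cp' : drop_constant p cp -> drop_constant p cp' -> cp = cp'.
Proof.
case: cp => c p1; case: cp' => c' p1'.
case=> d [a [b [mon co /= -> ->]]] [d' [a' [b' [mon' co' /= /[dup] /(congr1 fst) /= ea /(congr1 snd) /= eb ->]]]].
have [ed -> ->] := coprime_in_factor_uniq (monic_MXaddC c mon)
  (monic_MXaddC c' mon') co co' ea eb.
have ec : c = c'.
  (* The constant is recovered by evaluating at 0. *)
  by have := congr1 (fun q => q.[0]) ed; rewrite !hornerE.
by move: ed; rewrite ec => /addIr /(mulIf (negbT (polyX_eq0 F))) ->.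
Qed.

(** [drop_constant] is a bijection between the two sides. A nonconstant monic factor is d * x + c
    for unique monic [d] and constant [c]; since [d] may be 1, all pairs of degrees [m'], [n']
    occur. *)
Lemma ncard_not_coprime_in m n m' n' :
  (forall i, m i = ((i == x) + m' i)%N) -> (forall i, n i = ((i == x) + n' i)%N) ->
  ncard (monic_pairs m n `\` coprime_in_pairs m n) =
  (#|F| * ncard (monic_pairs (F := F) m' n'))%N.
Proof.
move=> em en; rewrite -ncard_setT -ncardX; [|exact: finite_finset|exact: finite_monic_pairs].
have deg (d : {poly F}) c : d \is monic ->
    (size (d * 'X + c%:P)).-1 = (size d).-1.+1.
  move=> mon; rewrite size_MXaddC (negbTE (monic_neq0 mon)) /= prednK //.
  by rewrite size_poly_gt0 monic_neq0.
have trans d c a (l l' : {ffun 'I_k -> nat}) : d \is monic -> (forall i, l i = ((i == x) + l' i)%N) ->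
    monics l (ev x (d * 'X + c%:P) * a) <-> monics l' (ev x d * a).
  move=> mon el; rewrite !monics_evM ?monic_MXaddC //.
  split=> -[a1 e]; split=> // i; last by rewrite el e deg // mulnS addnA.
  by apply/eqP; rewrite -(eqn_add2l (i == x)) -el e deg // mulnS addnA.
apply/eqP; rewrite eqn_leq; apply/andP; split.
  apply: (leq_ncard_rel (R := drop_constant)).
  - by apply: finite_setX; [exact: finite_finset | exact: finite_monic_pairs].
  - move=> [f g] [[/= mf mg] nco].
    have [d [a [b [mon ef eg co]]]] := coprime_in_factor x g (mleadc1_neq0 (proj1 mf)).
    (* Only the case split into 0 and d * x + c is used, without the induction hypothesis. *)
    elim/poly_ind: d => [|d c _] in mon ef eg *; first by rewrite monicE lead_coef0 eq_sym oner_eq0 in mon.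
    (* For [d = 0] the common factor is a monic constant, so [f] and [g] would themselves be coprime
       over F[x]. *)
    have [d0|d0] := eqVneq d 0.
      case: nco; split=> //=; move: ef eg; rewrite d0 mul0r add0r.
      move: mon; rewrite d0 mul0r add0r monicE lead_coefC => /eqP ->.
      by rewrite rmorph1 !mul1r => -> ->.
    have mon' : d \is monic.
      move: mon; rewrite !monicE [lead_coef (_ + _)]lead_coefE size_MXaddC (negbTE d0) /=.
      by rewrite coefD coefMX coefC size_poly_eq0 (negbTE d0) addr0 -lead_coefE.
    exists (c, (ev x d * a, ev x d * b)); last by exists d, a, b; rewrite ef eg.
    by split=> //; split; [apply/(trans d c a m) | apply/(trans d c b n)]; rewrite -?ef -?eg.
  - by move=> p p' cp _ _; apply: drop_constant_inj.
apply: (leq_ncard_rel (R := fun cp p => drop_constant p cp)).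
- by apply: finite_setD; exact: finite_monic_pairs.
- move=> [c [f g]] [_ [/= mf mg]].
  have [d [a [b [mon ef eg co]]]] := coprime_in_factor x g (mleadc1_neq0 (proj1 mf)).
  exists (ev x (d * 'X + c%:P) * a, ev x (d * 'X + c%:P) * b); last by exists d, a, b; rewrite ef eg.
  split; first by split; [apply/(trans d c a m m') | apply/(trans d c b n n')]; rewrite -?ef -?eg.
  case=> _ /= H; have : (size (d * 'X + c%:P)%R <= 1)%N.
    by apply: H; [exists a; rewrite mulrC | exists b; rewrite mulrC].
  by rewrite leqNgt size_MXaddC (negbTE (monic_neq0 mon)) /= ltnS size_poly_gt0 monic_neq0.
by move=> cp cp' p _ _; apply: drop_constant_fun.
Qed.

Lemma coprime_in_of_is_gcd f g : is_gcd 1 f g -> coprime_in x f g.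
Proof.
case=> _ _ H d df dg; have [h /esym e] := H _ df dg.
have := oner_neq0 {mpoly F[k]}; rewrite -e mulf_eq0 negb_or => /andP[h0 d0].
have := congr1 (fun f => vdeg f x) e; rewrite vdegM // vdeg_ev eqxx mul1n.
have -> : vdeg (1 : {mpoly F[k]}) x = 0%N by rewrite -(rmorph1 (ev x)) vdeg_ev size_poly1 muln0.
by move/eqP; rewrite addn_eq0 => /andP[_]; rewrite -subn1 subn_eq0.
Qed.

(** Some common divisor [e] does not divide 1. If it involved no variable besides x, it would lie in
    F[x], hence be a nonzero constant and a unit. *)
Lemma common_divisor_of_coprime_in f g : f != 0 -> coprime_in x f g -> ~ is_gcd 1 f g ->
  exists e f' g', [/\ f = e * f', g = e * g' & exists2 i, i != x & (0 < vdeg e i)%N].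
Proof.
move=> f0 co ngcd.
have [e [[f' ef] [[g' eg] ne]]] : exists e, mdivides e f /\ mdivides e g /\ ~ mdivides e 1.
  apply: contra_notP ngcd => H; split; [by exists f; rewrite mulr1|by exists g; rewrite mulr1|].
  by move=> e ef eg; apply: contrapT => ne; apply: H; exists e.
exists e, f', g'; split; [by rewrite mulrC | by rewrite mulrC |].
apply: contrapT => H; apply: ne.
have [i nix|d ed] := ev_of_vdeg (x := x) (f := e).
  by apply/eqP; rewrite -leqn0 leqNgt; apply/negP => lt; apply: H; exists i.
have size_d : (size d <= 1)%N by apply: co; [exists f' | exists g']; rewrite -ed.
have d0 : d != 0 by apply: contra_neq f0 => d0; rewrite ef ed d0 rmorph0 mulr0.
have /size_poly1P[c c0 ec] : size d == 1%N by rewrite eqn_leq size_d size_poly_gt0.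
by exists (ev x (c^-1)%:P); rewrite ed ec -rmorphM -polyCM mulVf // !rmorph1.
Qed.

End CommonFactors.

(** * Numerical bounds for the error term *)

Section ExponentBound.
Local Open Scope nat_scope.
Variable I : finType.
Implicit Types (P : pred I) (l r m n : I -> nat).

(** Expanding the right-hand product gives 1, the nonconstant terms in [l] alone, those in [r]
    alone, and nonnegative mixed terms. *)
Lemma leq_prodS_add P l r :
  \prod_(i | P i) (l i).+1 + \prod_(i | P i) (r i).+1 <=
  (\prod_(i | P i) (l i + r i).+1).+1.
Proof.
have [+ _ _] : [/\ \prod_(i | P i) (l i).+1 + \prod_(i | P i) (r i).+1 <=
    (\prod_(i | P i) (l i + r i).+1).+1, 0 < \prod_(i | P i) (l i).+1
    & 0 < \prod_(i | P i) (r i).+1]; last by [].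
elim/big_rec3: _ => [|i a b c _ [le_bca c0 b0]]; first by [].
by split; nia.
Qed.

Lemma leq_sum_prodS P l : \sum_(i | P i) l i < \prod_(i | P i) (l i).+1.
Proof.
elim/big_rec2: _ => [|i a b _ lt]; first by [].
by nia.
Qed.

(* The summand [\sum_i l i] is the slack that makes the sum over [l] converge
   geometrically.  With A = prod_{i != j} (m i + 1) and so on, the
   two sides differ by at least (m j + n j - l j - 2) * (L - 1) >= 0, because
   A >= L + A' - 1 and B >= L + B' - 1. *)
Lemma exponent_bound m n l j :
  (forall i, l i <= minn (m i) (n i)) -> 0 < l j -> 1 < maxn (m j) (n j) ->
  \prod_i (l i).+1 + (\prod_i (m i - l i).+1 + \prod_i (n i - l i).+1) + \sum_i l i
  <= m j * \prod_(i | i != j) (m i).+1 + n j * \prod_(i | i != j) (n i).+1 + 3.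
Proof.
move=> le_l lj0 mn_j; have := le_l j.
rewrite ![\prod_i _](bigD1 j) //= [\sum_i _](bigD1 j) //=.
have := leq_prodS_add (fun i => i != j) l (fun i => m i - l i).
have := leq_prodS_add (fun i => i != j) l (fun i => n i - l i).
under [X in _ <= X.+1 -> _]eq_bigr => i _ do rewrite subnKC ?(leq_trans (le_l i)) ?geq_minr //.
under [X in _ -> _ <= X.+1 -> _]eq_bigr => i _ do rewrite subnKC ?(leq_trans (le_l i)) ?geq_minl //.
have := leq_sum_prodS (fun i => i != j) l.
have : 0 < \prod_(i | i != j) (m i - l i).+1 by apply: prodn_gt0.
have : 0 < \prod_(i | i != j) (n i - l i).+1 by apply: prodn_gt0.
move: (\prod_(i | _) (n i - _).+1) (\prod_(i | _) (m i - _).+1) => B' A'.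
move: (\prod_(i | _) (n i).+1) (\prod_(i | _) (m i).+1) => B A.
move: (\prod_(i | _) (l i).+1) (\sum_(i | _) l i) => L s.
move: (l j) (m j) (n j) lj0 mn_j => y a b y0 ab B'0 A'0 ltsL leB leA.
rewrite leq_min => /andP[leya leyb].
have leaA : a * (L + A').-1 <= a * A by rewrite leq_mul2l; lia.
have lebB : b * (L + B').-1 <= b * B by rewrite leq_mul2l; lia.
(* This is where max > 1 enters: together with 0 < y <= min(a, b) it gives a + b >= y + 2. The
   witnesses that follow remove truncated subtraction. *)
have [c ec] : exists c, a + b = y + c + 2 by exists (a + b - y - 2); lia.
have [L0 eL] : exists L0, L = L0.+1 by exists L.-1; lia.
have [A0 eA] : exists A0, A' = A0.+1 by exists A'.-1; lia.
have [B0 eB] : exists B0, B' = B0.+1 by exists B'.-1; lia.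
have [a0 ea] : exists a0, a = y + a0 by exists (a - y); lia.
have [b0 eb] : exists b0, b = y + b0 by exists (b - y); lia.
have [y1 ey] : exists y1, y = y1.+1 by exists y.-1; lia.
subst; rewrite !addKn; rewrite /= in leaA lebB.
(* Multiplying this linear relation by [L0] supplies a nonlinear fact for the final arithmetic. *)
have : L0 * (y1 + a0 + b0) = L0 * (c + 1) by congr (_ * _); lia.
move=> {leA leB ab leya leyb}; nia.
Qed.

Lemma leq_geometric q b : 1 < q -> \sum_(t < b) q ^ (b - t) <= 2 * q ^ b.
Proof.
(* The extra 2 makes the induction close: S + 2 <= 2 q^b <= q^(b+1). *)
move=> q1; suff : \sum_(t < b) q ^ (b - t) + 2 <= 2 * q ^ b by lia.
elim: b => [|b IH]; first by rewrite big_ord0.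
rewrite big_ord_recl subn0 /=; under eq_bigr do rewrite /bump add1n subSS.
rewrite expnS; move: IH; move: (q ^ b) (\sum_(_ < b) _) => X S; nia.
Qed.

(** Each term is at most q^e times the product of the q^(-l i). Scaling by q^(#|I| b) keeps the
    weights integral, and the sum over [l] factors into #|I| geometric sums, each at most 2 q^b. *)
Lemma leq_sum_weighted q b (Q : pred {ffun I -> 'I_b}) (T : {ffun I -> 'I_b} -> nat) e :
  1 < q -> (forall l : {ffun I -> 'I_b}, Q l -> T l * q ^ (\sum_i l i) <= q ^ e) ->
  \sum_(l | Q l) T l <= 2 ^ #|I| * q ^ e.
Proof.
move=> q1 bnd; have q0 : 0 < q by apply: ltnW.
have qb : 0 < q ^ (#|I| * b) by rewrite expn_gt0 q0.
rewrite -(leq_pmul2r qb) big_distrl /=.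
have wt (l : {ffun I -> 'I_b}) : q ^ (#|I| * b) = q ^ (\sum_i l i) * \prod_i q ^ (b - l i).
  rewrite -expn_sum -expnD -big_split /=; congr (q ^ _).
  rewrite -sum_nat_const; apply: eq_bigr => i _; rewrite subnKC //.
  exact/ltnW/ltn_ord.
apply: (@leq_trans (\sum_(l : {ffun I -> 'I_b}) q ^ e * \prod_i q ^ (b - l i))).
  rewrite big_mkcond /=; apply: leq_sum => l _; case: ifP => // Ql.
  by rewrite (wt l) mulnA leq_mul2r bnd ?orbT.
rewrite -big_distrr /= -(bigA_distr_bigA (fun (_ : I) (t : 'I_b) => q ^ (b - t))) /=.
rewrite -mulnA mulnCA leq_mul2l; apply/orP; right.
apply: leq_trans (leq_prod (fun _ _ => leq_geometric b q1)) _.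
by rewrite prod_nat_const expnMn -expnM mulnC [b * _]mulnC mulnC.
Qed.
End ExponentBound.

(** * Pairs with a common factor involving another variable *)

Section MixedCommonFactors.
Local Open Scope classical_set_scope.
Variables (F : finFieldType) (k : nat) (x : 'I_k).
Implicit Types (f g e : {mpoly F[k]}) (m n l : {ffun 'I_k -> nat}).

(** The triple (e, f, g) determines the pair; here [m] and [n] are the degrees of the cofactors. *)
Lemma ncard_common_factor m n l :
  (ncard [set p : {mpoly F[k]} * {mpoly F[k]} |
      exists e f g, [/\ p = (e * f, e * g)%R, monics l e, monics m f & monics n g]]
   <= #|F| ^ (\prod_i (l i).+1 + (\prod_i (m i).+1 + \prod_i (n i).+1)))%N.
Proof.
have finX : finite_set (monics (F := F) l `*` (monics (F := F) m `*` monics (F := F) n)).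
  by do ?[apply: finite_setX]; exact: finite_monics.
apply: (@leq_trans (ncard (monics (F := F) l `*` (monics (F := F) m `*` monics (F := F) n)))).
  apply: (leq_ncard_rel (R := fun p t => p = (t.1 * t.2.1, t.1 * t.2.2))) => //.
    by move=> _ [e [f [g [-> el fm gn]]]]; exists (e, (f, g)).
  by move=> p p' t _ _ -> ->.
rewrite !ncardX ?expnD; try by do ?[apply: finite_setX]; exact: finite_monics.
by do 2?[apply: leq_mul]; exact: ncard_monics_leq.
Qed.

(** A union bound over the vector degree [l] of a common divisor. The slack in [exponent_bound]
    provides the weights for [leq_sum_weighted]. *)
Lemma ncard_coprime_in_not_coprime m n E :
  (forall j : 'I_k, j != x -> (1 < maxn (m j) (n j))%N /\
    (m j * \prod_(i | i != j) (m i).+1 + n j * \prod_(i | i != j) (n i).+1 <= E)%N) ->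
  (ncard (coprime_in_pairs (F := F) x m n `\` coprime_monic_pairs m n)
   <= 2 ^ k * #|F| ^ (E + 3))%N.
Proof.
(* Every degree of a divisor of [f] is below [b], so the possible [l] form a finite type. *)
move=> hE; pose b := (\max_i m i).+1.
pose Q (l : {ffun 'I_k -> 'I_b}) :=
  [forall i, l i <= minn (m i) (n i)]%N && [exists i, (i != x) && (0 < l i)%N].
pose mons := @monics F k.
pose G (l : {ffun 'I_k -> 'I_b}) := [set p : {mpoly F[k]} * {mpoly F[k]} |
  exists e f g, [/\ p = (e * f, e * g), mons [ffun i => (l i : nat)] e,
    mons [ffun i => (m i - l i)%N] f & mons [ffun i => (n i - l i)%N] g]].
have finG (l : {ffun 'I_k -> 'I_b}) : finite_set (G l).
  apply: (@sub_finite_set _ _ (monic_pairs [ffun i => l i + (m i - l i)]%N [ffun i => l i + (n i - l i)]%N));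
    last exact: finite_monic_pairs.
  move=> _ [e [f [g [-> [e1 eD] [f1 fD] [g1 gD]]]]].
  by split; split=> /=; rewrite ?mleadc_mul ?e1 ?f1 ?g1 ?mulr1 //; apply/ffunP => i;
    rewrite vdegM ?mleadc1_neq0 // eD ?fD ?gD !ffunE.
apply: (@leq_trans (\sum_(l | Q l) ncard (G l))).
  apply: ncard_bigcup => // -[f g] [[[/= mf mg] co] ncp].
  have [f1 fD] := mf; have [g1 gD] := mg.
  have [f0 g0] := (mleadc1_neq0 f1, mleadc1_neq0 g1).
  have [|e [f' [g' [ef eg [j jx ej]]]]] := common_divisor_of_coprime_in f0 co.
    by move=> cop; apply: ncp.
  have e0 : e != 0 by apply: contra_neq f0 => e0; rewrite ef e0 mul0r.
  have f'0 : f' != 0 by apply: contra_neq f0 => e'; rewrite ef e' mulr0.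
  have g'0 : g' != 0 by apply: contra_neq g0 => e'; rewrite eg e' mulr0.
  have c0 : mleadc e != 0 by rewrite mleadc_eq0.
  have fi i : m i = (vdeg e i + vdeg f' i)%N by rewrite -fD ef vdegM.
  have gi i : n i = (vdeg e i + vdeg g' i)%N by rewrite -gD eg vdegM.
  have ltb i : (vdeg e i < b)%N.
    by rewrite ltnS; apply: leq_trans (leq_bigmax i); rewrite fi leq_addr.
  exists [ffun i => Ordinal (ltb i)].
    apply/andP; split; last by apply/existsP; exists j; rewrite jx ffunE.
    by apply/forallP => i; rewrite (ffunE (fun i => Ordinal (ltb i))) /= leq_min fi gi !leq_addr.
  (* The common divisor is made monic by moving its leading coefficient to the cofactors. *)
  have scal h : (mleadc e)^-1 *: e * (mleadc e *: h) = e * h.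
    by rewrite -scalerAl -scalerAr scalerA mulVf // scale1r.
  have lead h : mleadc (e * h) = 1 -> mleadc (mleadc e *: h) = 1.
    by rewrite mleadc_mul mleadcZE.
  exists ((mleadc e)^-1 *: e), (mleadc e *: f'), (mleadc e *: g'); split.
  - by rewrite !scal ef eg.
  - split; first by rewrite mleadcZE mulVf.
    by rewrite vdegZ ?invr_eq0 //; apply/ffunP => i; rewrite [RHS]ffunE (ffunE (fun i => Ordinal (ltb i))).
  - split; first by apply: lead; rewrite -ef.
    by rewrite vdegZ //; apply/ffunP => i; rewrite [RHS]ffunE (ffunE (fun i => Ordinal (ltb i))) /= fi addKn.
  split; first by apply: lead; rewrite -eg.
  by rewrite vdegZ //; apply/ffunP => i; rewrite [RHS]ffunE (ffunE (fun i => Ordinal (ltb i))) /= gi addKn.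
rewrite -[k in (2 ^ k)%N]card_ord; apply: leq_sum_weighted; first exact: card_finNzRing_gt1.
move=> l /andP[/forallP le_l /existsP[j /andP[jx lj0]]].
have [mnj leE] := hE j jx.
have := exponent_bound (m := m) (n := n) (l := fun i => l i) le_l lj0 mnj.
move/leq_trans => /(_ (E + 3)%N); rewrite leq_add2r => /(_ leE) le_exp.
apply: leq_trans (leq_pexp2l (ltnW (card_finNzRing_gt1 F)) le_exp).
rewrite [X in (_ <= X)%N]expnD leq_mul2r; apply/orP; right.
apply: leq_trans (ncard_common_factor _ _ _) _.
apply: eq_leq; congr (_ ^ (_ + (_ + _)))%N; apply: eq_bigr => i _; by rewrite ffunE.
Qed.
End MixedCommonFactors.

(* The division in the exponent is exact, since (m j).+1 divides the product. *)
Theorem theorem5p8 (q k : nat) (hk : (2 <= k)%N) :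
  exists C : nat, forall F : finFieldType, #|F| = q ->
  forall m n : {ffun 'I_k -> nat},
    (forall i : 'I_k, i.+1 = k -> (0 < m i)%N /\ (0 < n i)%N) ->
    (forall i : 'I_k, (i.+1 < k)%N -> (1 < maxn (m i) (n i))%N) ->
    `| (Pcount F m n)%:Z
       - ((Ncount F m)%:Z * (Ncount F n)%:Z
          - q%:Z * (Ncount F (pred_last m))%:Z * (Ncount F (pred_last n))%:Z) |
    <= C%:Z * q%:Z ^+
         (\max_(j < k | (j.+1 < k)%N)
            ((m j * \prod_(i < k) (m i).+1) %/ (m j).+1
             + (n j * \prod_(i < k) (n i).+1) %/ (n j).+1))%N.
Proof.
(* The factor 2^k comes from the k geometric sums, and q^3 from the excess 3 in [exponent_bound]. *)
exists (2 ^ k * q ^ 3)%N => F cardF m n mn_last mn_gt1.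
set E := (\max_(j < k | _) _)%N.
have ltk : (k.-1 < k)%N by rewrite prednK // ltnW.
pose x := Ordinal ltk.
have xP (i : 'I_k) : (i.+1 == k) = (i == x).
  by rewrite -val_eqE /= -[RHS]eqSS prednK // ltnW.
(* Positivity of the last coordinate keeps the predecessor in [pred_last] from truncating. *)
have shift (l : {ffun 'I_k -> nat}) : (forall i : 'I_k, i.+1 = k -> 0 < l i)%N ->
    forall i, l i = ((i == x) + pred_last l i)%N.
  move=> l0 i; rewrite ffunE xP; case: eqVneq => [e|_] //=.
  by rewrite add1n prednK // l0 //; apply/eqP; rewrite xP e.
have h1 := ncard_not_coprime_in F (shift m (fun i e => proj1 (mn_last i e)))
  (shift n (fun i e => proj2 (mn_last i e))).
have h2 : (ncard (coprime_in_pairs (F := F) x m n `\` coprime_monic_pairs m n)%classic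
   <= 2 ^ k * #|F| ^ (E + 3))%N.
  apply: ncard_coprime_in_not_coprime => j jx.
  have ltj : (j.+1 < k)%N by rewrite ltn_neqAle xP jx ltn_ord.
  split; first exact: mn_gt1.
  have divE (l : {ffun 'I_k -> nat}) :
      ((l j * \prod_(i < k) (l i).+1) %/ (l j).+1 = l j * \prod_(i < k | i != j) (l i).+1)%N.
    by rewrite (bigD1 j) //= mulnCA mulKn.
  by rewrite -!divE; apply: (leq_bigmax_cond (P := fun j : 'I_k => (j.+1 < k)%N)).
have sub1 : (coprime_in_pairs (F := F) x m n `<=` monic_pairs m n)%classic by move=> p [].
have sub2 : (coprime_monic_pairs m n `<=` coprime_in_pairs (F := F) x m n)%classic.
  by move=> p [mp co]; split=> //; apply: coprime_in_of_is_gcd.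
have fin := finite_monic_pairs F m n.
have := ncardD fin sub1; rewrite h1.
have := ncardD (sub_finite_set sub1 fin) sub2.
rewrite ncard_coprime_monic_pairs !ncardX; try exact: finite_monics.
rewrite !ncard_monics cardF.
move: h2; rewrite cardF expnD; set r := ncard _.
move=> le_r e1 e2.
(* The error is exactly -r, where [r] counts the pairs coprime over F[x] but not coprime. *)
have -> : (Pcount F m n)%:Z - ((Ncount F m)%:Z * (Ncount F n)%:Z
      - q%:Z * (Ncount F (pred_last m))%:Z * (Ncount F (pred_last n))%:Z) = - r%:Z.
  rewrite -!PoszM -e2 -e1 -mulnA !PoszD; lia.
rewrite normrN; have -> : q%:Z ^+ E = (q ^ E)%N by rewrite -[q%:Z]natz -natrX natz.
by rewrite -PoszM -mulnA [(q ^ 3 * _)%N]mulnC.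
Qed.
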